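(* Let $p=p(n)$ be a sequence satisfying $n^{-1/9}\log^2 n<p(n)<1-n^{-1/9}\log^2 n$ for all sufficiently large $n$. For each such $n$, let $D$ and $C$ be random digraphs on a common probability space, each with the distribution $D(n,p(n))$ (no assumption is made on their joint distribution; in particular $C=D$ is allowed). Then asymptotically almost surely every acyclic homomorphism $f\colon V(D)\to V(C)$ is injective; that is, the probability that every acyclic homomorphism of $D$ to $C$ is injective tends to $1$ as $n\to\infty$.
   Context: Digraphs are simple: loopless and without multiple arcs, but two oppositely directed arcs $uv$ and $vu$ between the same two vertices are allowed. $V(D)$ and $A(D)$ denote the vertex set and arc set of $D$. A cycle in a digraph is a directed cycle (two oppositely directed arcs $uv,vu$ form a directed cycle of length 2); a digraph is acyclic if it contains no directed cycle. For a natural number $n$ and $0\le p\le 1$, $D(n,p)$ is the random digraph on vertex set $[n]=\{1,\dots,n\}$ in which each ordered pair of distinct vertices is joined by an arc with probability $p$, with the arcs chosen independently. A digraph property holds asymptotically almost surely (a.a.s.) if its probability tends to $1$ as $n\to\infty$. An acyclic homomorphism of a digraph $D$ to a digraph $C$ is a function $\rho\colon V(D)\to V(C)$ such that: (i) for every arc $uv\in A(D)$, either $\rho(u)=\rho(v)$, or $\rho(u)\rho(v)$ is an arc of $C$; and (ii) for every vertex $v\in V(C)$, the subdigraph of $D$ induced by $\rho^{-1}(v)$ is acyclic. Here $\log$ is the natural logarithm. *)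

(* Defs.v *)
From HB Require Import structures.
From mathcomp Require Import all_boot all_order all_algebra.
From mathcomp Require Import all_classical all_reals all_analysis.
Import Order.TTheory GRing.Theory Num.Theory.
Import numFieldNormedType.Exports.

Set Implicit Arguments.
Unset Strict Implicit.
Unset Printing Implicit Defensive.

Local Open Scope classical_set_scope.
Local Open Scope ring_scope.

Record digraph (V : finType) := Digraph {
  arc :> rel V;
  arc_irrefl : irreflexive arc
}.

(* Since digraphs are loopless, a simple closed walk [c] has length at least
   2; length 2 is a pair of opposite arcs. *)
Definition directed_cycle (V : finType) (G : digraph V) (c : seq V) : Prop :=
  c <> [::] /\ ucycle G c.

Definition acyclic (V : finType) (G : digraph V) : Prop :=
  forall c : seq V, ~ directed_cycle G c.

Section InducedSubdigraph.
Variables (V : finType) (G : digraph V) (S : {set V}).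

Definition induced_arc : rel {v : V | v \in S} :=
  fun u v => G (val u) (val v).

Lemma induced_arc_irrefl : irreflexive induced_arc.
Proof. by move=> u; exact: arc_irrefl. Qed.

Definition induced : digraph {v : V | v \in S} := Digraph induced_arc_irrefl.

End InducedSubdigraph.

Definition acyclic_hom (V W : finType) (D : digraph V) (C : digraph W)
    (f : V -> W) : Prop :=
  (forall u v : V, D u v -> f u = f v \/ C (f u) (f v)) /\
  (forall w : W, acyclic (induced D [set v | f v == w]%SET)).

(* Mutual independence of the events [E i], for [i] in [J]. *)
Definition mutually_independent (d : measure_display) (T : measurableType d)
    (R : realType) (P : probability T R) (I : finType) (J : {set I})
    (E : I -> set T) : Prop :=
  forall S : {set I}, S \subset J ->
    P (\bigcap_(i in [set` S]) E i) = (\prod_(i in S) P (E i))%E.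

(* [G] is a random variable with the distribution D(n, p), on the vertex set
   'I_n. As there are finitely many digraphs on 'I_n, measurability of [G]
   amounts to measurability of the arc events. *)
Definition random_digraph (d : measure_display) (T : measurableType d)
    (R : realType) (P : probability T R) (n : nat) (p : R)
    (G : T -> digraph 'I_n) : Prop :=
  let arc_event (e : 'I_n * 'I_n) := [set t | G t e.1 e.2] in
  let pairs := [set e : 'I_n * 'I_n | e.1 != e.2]%SET in
  [/\ forall e, e \in pairs -> measurable (arc_event e),
      forall e, e \in pairs -> P (arc_event e) = p%:E
    & mutually_independent P pairs arc_event].

Definition in_window (R : realType) (n : nat) (x : R) : Prop :=
  let b : R := n%:R `^ (- (1 / 9)) * ln n%:R ^+ 2 in b < x < 1 - b.

(* Main.v *)
Require Import Defs.
From HB Require Import structures.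
From mathcomp Require Import all_boot all_order all_algebra.
From mathcomp Require Import all_classical all_reals all_analysis.
From mathcomp Require Import ring lra zify.
Import Order.TTheory GRing.Theory Num.Theory.
Import numFieldNormedType.Exports.
Set Implicit Arguments.
Unset Strict Implicit.
Unset Printing Implicit Defensive.
Local Open Scope classical_set_scope.
Local Open Scope ring_scope.

(** Write q = 1 - p, s = p q and e = s / 4. Suppose f is an acyclic
homomorphism with f u = f v = w and u <> v. An arc from u or v to x forces
f x = w or an arc from w to f x, so f maps the roughly (1 - q^2) n vertices
dominated by u or v into w and its roughly p n out-neighbours, and only about
q^2 n vertices are not dominated. As p + q^2 = 1 - s, the image of f misses
about s n vertices: a single collision forces many ([card_image_le]).

Fibres of f are small, because an acyclic set contains no digon (pair of
opposite arcs), while any two disjoint k-sets of a random digraph, k of order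
log n / p^2, are joined by a digon ([card_fibre_lt]). So the collisions are
spread over many fibres: there are 2m vertices w_1, ..., w_m, w'_1, ..., w'_m
with two preimages each, u_i, v_i over w_i and u'_j, v'_j over w'_j. Whenever
D has one of the arcs u_i u'_j and v_i v'_j, C has the arc w_i w'_j. The former
happens for about (1 - q^2) m^2 pairs (i, j), the latter for about p m^2, and
1 - q^2 - p = s > 0. This contradiction is [acyclic_hom_injective]; it uses
only counting properties of D and of C separately, which is why the joint law
of D and C does not matter.

Each counting property fails with probability at most 1 / n: a Chernoff bound
([prob_tail]) gives failure probability exp (- e^2 N / 8) for each choice of
vertices, where N is the number of independent trials, and the union bound
over all choices costs n^O(1) when N is about n, and n^(4m) when N = m^2. With
r = floor (n^(1/9)), k = (r + 1)^2 and m = r^6 the window for p makes the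
exponents win ([window_parameters]).

All probability is done for weights on a finite set, the set of pairs of
possible arc patterns of D and C; [prob_pushforward] carries the estimate back
to the original probability space, where the events involved are measurable as
finite unions of level sets of the patterns ([measurable_finite_preimage]). *)

(** * Independent events on a finite weighted set *)

Section FiniteProbability.
Context {R : realType} {O : finType}.
Variable mu : O -> R.
Hypothesis mu_ge0 : forall w, 0 <= mu w.

Definition prob (Q : pred O) : R := \sum_(w | Q w) mu w.

Lemma prob_sub (Q Q' : pred O) : subpred Q Q' -> prob Q <= prob Q'.
Proof.
move=> QQ'; rewrite /prob [leRHS](bigID Q) /=.
rewrite -[leLHS]addr0 lerD ?sumr_ge0 //.
by rewrite le_eqVlt (eq_bigl Q) ?eqxx// => w; case: (boolP (Q w)) => [/QQ' ->|]//; rewrite andbF.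
Qed.

Lemma prob_or (Q Q' : pred O) : prob (fun w => Q w || Q' w) <= prob Q + prob Q'.
Proof.
rewrite /prob [leLHS]big_mkcond (big_mkcond Q) (big_mkcond Q') -big_split /=.
apply: ler_sum => w _; have := mu_ge0 w.
by case: (Q w); case: (Q' w); rewrite /= ?addr0 ?add0r //; lra.
Qed.

Lemma prob_exists (I : finType) (A : {set I}) (Q : I -> pred O) :
  prob (fun w => [exists i in A, Q i w]) <= \sum_(i in A) prob (Q i).
Proof.
rewrite /prob [leLHS]big_mkcond; under [leRHS]eq_bigr do rewrite big_mkcond.
rewrite exchange_big; apply: ler_sum => w _.
case: ifP => [/exists_inP[i iA Qi]|_].
  by rewrite (bigD1 i) //= Qi lerDl sumr_ge0 // => j _; case: ifP.
by apply: sumr_ge0 => j _; case: ifP.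
Qed.

Lemma prob_exists_le (I : finType) (A : {set I}) (Q : I -> pred O) (c : R) :
  0 <= c -> (forall i, i \in A -> prob (Q i) <= c) ->
  prob (fun w => [exists i in A, Q i w]) <= #|I|%:R * c.
Proof.
move=> c0 Qc; apply: le_trans (prob_exists _ _) _; apply: le_trans (ler_sum _ Qc) _.
by rewrite sumr_const -[leLHS]mulr_natl ler_wpM2r// ler_nat max_card.
Qed.

(** Independence of events of common probability [r], by the product rule for
intersections. As it speaks of all subfamilies, it passes to complements, to
families of distinct members and to conjunctions over disjoint pairs. *)
Definition independent (I : finType) (X : I -> pred O) (r : R) (J : {set I}) :=
  forall S : {set I}, S \subset J -> prob (fun w => [forall i in S, X i w]) = r ^+ #|S|.

Lemma prodr_1D (I : finType) (J : {set I}) (x : I -> R) :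
  \prod_(i in J) (1 + x i) = \sum_(S : {set I} | S \subset J) \prod_(i in S) x i.
Proof.
under eq_bigr do rewrite addrC.
pose y i := if i \in J then x i else 0.
transitivity (\prod_i (y i + 1)).
  by rewrite big_mkcond; apply: eq_bigr => i _; rewrite /y; case: ifP; rewrite ?add0r.
rewrite bigA_distr [RHS]big_mkcond; apply: eq_bigr => S _.
rewrite -big_mkcond /=; case: ifP => [SJ|/negbT/subsetPn[i iS iJ]].
  by apply: eq_bigr => i iS; rewrite /y (fintype.subsetP SJ).
by rewrite (bigD1 i)//= /y (negbTE iJ) mul0r.
Qed.

(** Expanding the product over subsets of [J] only involves probabilities of
intersections, so the product rule determines this expectation. With [c = -1]
the product is the indicator that no event occurs; with [1 + c = expR l] it is
the exponential moment of the number of events. *)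
Lemma independent_expansion (I : finType) (X : I -> pred O) r (J : {set I}) c :
  independent X r J ->
  \sum_w mu w * \prod_(i in J) (1 + c * (X i w)%:R) = (1 + c * r) ^+ #|J|.
Proof.
move=> Xr; rewrite -prodr_const prodr_1D.
under eq_bigr => w _ do rewrite prodr_1D big_distrr /=.
rewrite exchange_big /=; apply: eq_bigr => S SJ.
rewrite prodr_const exprMn -(Xr S SJ) /prob big_distrr /= [RHS]big_mkcond.
apply: eq_bigr => w _; rewrite big_split /= prodr_const mulrCA.
case: ifP => [/forall_inP XS|/negbT].
  by rewrite [X in _ * (_ * X)]big1 ?mulr1// => i /XS ->.
rewrite negb_forall_in => /exists_inP[i iS /negbTE Xi].
by rewrite (bigD1 i)//= Xi mul0r !mulr0.
Qed.

Lemma independent_sub (I : finType) (X : I -> pred O) r (J K : {set I}) :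
  K \subset J -> independent X r J -> independent X r K.
Proof. by move=> KJ Xr S SK; apply: Xr; apply: (fintype.subset_trans SK). Qed.

Lemma independent_compl (I : finType) (X : I -> pred O) r (J : {set I}) :
  independent X r J -> independent (fun i w => ~~ X i w) (1 - r) J.
Proof.
move=> Xr S SJ; have := independent_expansion (-1) (independent_sub SJ Xr).
rewrite mulN1r => <-; rewrite /prob big_mkcond; apply: eq_bigr => w _.
case: ifP => [/forall_inP XS|/negbT].
  by rewrite big1 ?mulr1// => i /XS/negbTE ->; rewrite mulr0 addr0.
rewrite negb_forall_in => /exists_inP[i iS /negbNE Xi].
by rewrite (bigD1 i)//= Xi mulr1 subrr mul0r mulr0.
Qed.

Lemma independent_inj (I K : finType) (X : I -> pred O) r (J : {set I})
    (g : K -> I) (A : {set K}) :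
  {in A &, injective g} -> (forall k, k \in A -> g k \in J) ->
  independent X r J -> independent (fun k => X (g k)) r A.
Proof.
move=> gI gJ Xr S SA; have SA' := fintype.subsetP SA.
have -> : #|S| = #|g @: S|.
  by rewrite card_in_imset// => k l kS lS; apply: gI; apply: SA'.
rewrite -Xr; last by apply/fintype.subsetP => _ /imsetP[k /SA' kA ->]; apply: gJ.
apply: eq_bigl => w; apply/forall_inP/forall_inP => [H _ /imsetP[k kS ->]|H k kS].
  exact: H.
by apply: H; apply: imset_f.
Qed.

Lemma independent_inj2 (I K : finType) (X : I -> pred O) r (J : {set I})
    (g1 g2 : K -> I) (A : {set K}) :
  {in A &, injective g1} -> {in A &, injective g2} ->
  {in A &, forall k l, g1 k != g2 l} ->
  (forall k, k \in A -> g1 k \in J) -> (forall k, k \in A -> g2 k \in J) ->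
  independent X r J -> independent (fun k w => X (g1 k) w && X (g2 k) w) (r ^+ 2) A.
Proof.
move=> g1I g2I g12 g1J g2J Xr S SA; have SA' := fintype.subsetP SA.
have -> : (r ^+ 2) ^+ #|S| = r ^+ #|(g1 @: S :|: g2 @: S)%SET|.
  rewrite -exprM cardsU disjoint_setI0 ?cards0 ?subn0; last first.
    apply/pred0P => i /=; apply/negP => /andP[/imsetP[k kS ->] /imsetP[l lS]].
    by apply/eqP/g12; apply: SA'.
  rewrite !card_in_imset ?addnn ?mul2n// => k l kS lS; [apply: g2I|apply: g1I]; exact: SA'.
rewrite -Xr; last first.
  apply/fintype.subsetP => i; rewrite inE => /orP[] /imsetP[k /SA' kA ->]; auto.
apply: eq_bigl => w; apply/forall_inP/forall_inP => [H i|H k kS].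
  by rewrite inE => /orP[] /imsetP[k kS ->]; have /andP[] := H k kS.
by apply/andP; split; apply: H; rewrite inE imset_f ?orbT.
Qed.

Lemma prob_none (K : finType) (Y : K -> pred O) r (A : {set K}) :
  independent Y r A -> prob (fun w => [forall k in A, ~~ Y k w]) = (1 - r) ^+ #|A|.
Proof. by move=> /independent_compl; apply. Qed.

(** Chernoff bound: Markov's inequality for [expR (l * count)] with [l = e / 4],
using [expR l - 1 <= l + 2 * l ^+ 2]; per trial, the exponent is then at most
[2 * l ^+ 2 - l * e = - e ^+ 2 / 8]. *)
Lemma prob_tail (K : finType) (Y : K -> pred O) r (A : {set K}) e :
  0 <= r <= 1 -> 0 <= e <= 1 -> independent Y r A ->
  prob (fun w => (r + e) * #|A|%:R <= #|[set k in A | Y k w]%SET|%:R :> R)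
    <= expR (- (e ^+ 2 * #|A|%:R / 8)).
Proof.
move=> r01 e01 Yr; pose l := e / 4; pose c := expR l - 1.
have c0 : 0 <= c by rewrite /c; have := expR_ge1Dx l; rewrite /l; lra.
have cl : c <= l + 2 * l ^+ 2.
  have := expR_ge1Dx (- l); rewrite expRN => h.
  have E0 := expR_gt0 l.
  have : (1 - l) * expR l <= 1 by rewrite -ler_pdivlMr// div1r.
  have l01 : 0 <= l <= 1/4 by rewrite /l; lra.
  have : 0 <= l ^+ 2 * (1 - 2 * l) by rewrite mulr_ge0 ?sqr_ge0//; lra.
  (* [expR l <= (1 - l)^-1 <= 1 + l + 2 * l ^+ 2], cleared of the denominator. *)
  move=> h2 h1; rewrite /c lerBlDl -(@ler_pM2l _ (1 - l)); last lra.
  by apply: (le_trans h1); rewrite -subr_ge0; apply: le_trans h2 _; lra.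
pose M := expR (l * ((r + e) * #|A|%:R)).
have M0 : 0 < M by exact: expR_gt0.
apply: (@le_trans _ _ ((1 + c * r) ^+ #|A| / M)).
  rewrite ler_pdivlMr// -(independent_expansion c Yr) /prob mulrC big_distrr /=.
  rewrite [leLHS]big_mkcond; apply: ler_sum => w _; case: ifP => [h|_].
    rewrite mulrC ler_wpM2l//.
    have -> : \prod_(i in A) (1 + c * (Y i w)%:R) = expR l ^+ #|[set k in A | Y k w]%SET|.
      rewrite -prodr_const big_mkcond [RHS]big_mkcond; apply: eq_bigr => i _.
      rewrite inE; case: (i \in A) => //=; case: (Y i w); rewrite /= /c; lra.
    by rewrite -expRM_natr ler_expR /l ler_wpM2l//; lra.
  by rewrite mulr_ge0// prodr_ge0// => i _; rewrite addr_ge0// mulr_ge0.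
rewrite /M ler_pdivrMr// -expRD.
have c1 : 0 <= 1 + c * r by rewrite addr_ge0// mulr_ge0//; lra.
apply: (@le_trans _ _ (expR (c * r) ^+ #|A|)).
  by rewrite lerXn2r ?nnegrE ?expR_ge0// expR_ge1Dx.
rewrite -expRM_natr ler_expR.
have -> : - (e ^+ 2 * #|A|%:R / 8) + l * ((r + e) * #|A|%:R) =
  (l * (r + e) - e ^+ 2 / 8) * #|A|%:R by ring.
rewrite ler_wpM2r//.
have : c * r <= (l + 2 * l ^+ 2) * r by rewrite ler_wpM2r//; lra.
have : 2 * l ^+ 2 * r <= 2 * l ^+ 2 * 1.
  by rewrite ler_wpM2l ?mulr_ge0 ?sqr_ge0//; lra.
by rewrite /l; lra.
Qed.

End FiniteProbability.

(** * Homomorphisms between digraphs with pseudo-random arcs *)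

(** The [2k] values of [x] and [y] are distinct: two disjoint enumerated
[k]-sets. Counting arcs between two such sets, rather than inside one, keeps
all the [k * k] trials off the diagonal and makes them independent. *)
Definition separated {V : finType} {k : nat} (x y : {ffun 'I_k -> V}) : bool :=
  [&& injectiveb x, injectiveb y & [forall i, [forall j, x i != y j]]].

Lemma separatedP (V : finType) k (x y : {ffun 'I_k -> V}) :
  reflect [/\ injective x, injective y & forall i j, x i != y j] (separated x y).
Proof.
apply: (iffP and3P) => -[hx hy h]; split; try exact/injectiveP.
- by move=> i j; have /forallP/(_ i)/forallP/(_ j) := h.
- by apply/forallP => i; apply/forallP.
Qed.

Lemma separated_exists (V : finType) (A : {set V}) k : (k + k <= #|A|)%N ->
  exists x y : {ffun 'I_k -> V},
    [/\ separated x y, forall i, x i \in A & forall i, y i \in A].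
Proof.
move=> kA; have [->|k0] := posnP k.
  have [z _] : exists z : {ffun 'I_0 -> V}, true.
    by exists (finfun (fun i : 'I_0 => match notF (ltn_ord i) with end)).
  by exists z, z; split; [apply/separatedP; split|..]; case.
have [a0 a0A] : exists a, a \in A by apply/card_gt0P; lia.
pose s := enum A; have ss : size s = #|A| by rewrite -cardE.
have us : uniq s by exact: enum_uniq.
have xlt (i : 'I_k) : (i < size s)%N by rewrite ss; have := ltn_ord i; lia.
have ylt (i : 'I_k) : (k + i < size s)%N by rewrite ss; have := ltn_ord i; lia.
exists [ffun i : 'I_k => nth a0 s i], [ffun i : 'I_k => nth a0 s (k + i)].
split; first apply/separatedP; [split| |].
- by move=> i j; rewrite !ffunE => /eqP; rewrite nth_uniq// => /eqP/val_inj.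
- by move=> i j; rewrite !ffunE => /eqP; rewrite nth_uniq// eqn_add2l => /eqP/val_inj.
- by move=> i j; rewrite !ffunE nth_uniq//; have := ltn_ord i; lia.
- by move=> i; rewrite ffunE -mem_enum mem_nth.
- by move=> i; rewrite ffunE -mem_enum mem_nth.
Qed.

Lemma digon_not_acyclic (V : finType) (G : digraph V) (S : {set V}) u v :
  u \in S -> v \in S -> G u v -> G v u -> ~ acyclic (Defs.induced G S).
Proof.
move=> uS vS uv vu /(_ [:: exist _ u uS; exist _ v vS]); apply; split => //.
apply/andP; split; first by rewrite /= /induced_arc /= uv vu.
rewrite /= andbT inE; apply/eqP => -[uv']; move: uv.
by rewrite uv' arc_irrefl.
Qed.

Section CollisionCounting.
Context {R : realType} {V : finType}.
Variables (D C : digraph V) (f : V -> V).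
Hypothesis f_hom : acyclic_hom D C f.

Let fibre w := [set v | f v == w]%SET.

(** One collision [f u = f v] already bounds the image: a vertex outside the
fibre that is dominated by [u] or [v] is mapped to an out-neighbour of [f u],
and the others are counted one by one. *)
Lemma card_image_le u v : u != v -> f u = f v ->
  (#|f @: [set: V]%SET| <= 1 + #|[set x in [set~ f u] | C (f u) x]%SET|
     + #|[set x in ~: [set u; v] | ~~ D u x && ~~ D v x]%SET|)%N.
Proof.
move=> uv fuv; set N := [set x in [set~ _] | _]%SET.
set U := [set x in ~: _ | _]%SET.
have sub : f @: [set: V]%SET \subset (f u |: N :|: f @: U)%SET.
  apply/fintype.subsetP => _ /imsetP[x _ ->].
  have [fx|fx] := eqVneq (f x) (f u); first by rewrite fx !inE eqxx.
  have [xu|xu] := eqVneq x u; first by rewrite xu eqxx in fx.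
  have [xv|xv] := eqVneq x v; first by rewrite xv fuv eqxx in fx.
  have [hom _] := f_hom.
  case: (boolP (D u x)) => [/hom[/eqP|Cux]|Dux].
  - by rewrite eq_sym (negbTE fx).
  - by rewrite !inE fx Cux orbT.
  case: (boolP (D v x)) => [/hom|Dvx].
    by rewrite -fuv => -[/eqP|Cux]; [rewrite eq_sym (negbTE fx)|rewrite !inE fx Cux orbT].
  rewrite finset.in_setU; apply/orP; right; apply: imset_f.
  by rewrite !inE negb_or xu xv Dux Dvx.
apply: (leq_trans (subset_leq_card sub)).
apply: (leq_trans (leq_card_setU _ _)); apply: leq_add; last exact: leq_imset_card.
by apply: (leq_trans (leq_card_setU _ _)); rewrite cards1.
Qed.

(** A fibre with [2k] vertices would contain two disjoint [k]-sets, hence a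
digon, and would not be acyclic. *)
Lemma card_fibre_lt k :
  (forall x y : {ffun 'I_k -> V}, separated x y ->
     exists i j, D (x i) (y j) && D (y j) (x i)) ->
  forall w, (#|fibre w| < k + k)%N.
Proof.
move=> digon w; rewrite ltnNge; apply/negP => /separated_exists[x [y [sep xw yw]]].
have [i [j /andP[xy yx]]] := digon x y sep.
have [_ /(_ w)] := f_hom.
exact: digon_not_acyclic (xw i) (yw j) xy yx.
Qed.

Lemma card_le_image_fibres h : (forall w, #|fibre w| <= h)%N ->
  (#|V| <= #|f @: [set: V]%SET| + h * #|[set w | 1 < #|fibre w|]%SET|)%N.
Proof.
move=> fh; have -> : #|V| = (\sum_(v : V) 1)%N by rewrite sum1_card.
rewrite (partition_big f predT)//= mulnC -sum_nat_const.
rewrite -sum1_card [X in (_ <= X + _)%N]big_mkcond [X in (_ <= _ + X)%N]big_mkcond.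
rewrite -big_split; apply: leq_sum => w _ /=.
have -> : (\sum_(v | f v == w) 1 = #|fibre w|)%N.
  by rewrite -sum1_card; apply: eq_bigl => v; rewrite inE.
rewrite inE; case: ltnP => [_|]; first by apply: leq_trans (leq_addl _ _); exact: fh.
rewrite addn0; case: (posnP #|fibre w|) => [->//|/card_gt0P[v]].
rewrite inE => /eqP <- ?; rewrite imset_f //.
Qed.

(** The numbers [a] and [b] play the roles of the density [p] of arcs and of the
density [(1 - p) ^+ 2] of pairs of absent arcs, plus an error. The numerical
hypothesis leaves a gap of [4 * k * m] vertices outside the image, hence more
than [2 * m] fibres with at least two elements, and it forces [a + b <= 1]. *)
Lemma acyclic_hom_injective (k m : nat) (a b : R) :
  0 <= a -> 0 <= b ->
  1 + a * #|V|%:R + b * #|V|%:R + (4 * k * m)%:R <= #|V|%:R ->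
  (forall w, #|[set x in [set~ w] | C w x]%SET|%:R < a * #|[set~ w]%SET|%:R) ->
  (forall u v, u != v ->
     #|[set x in ~: [set u; v] | ~~ D u x && ~~ D v x]%SET|%:R
       < b * #|(~: [set u; v])%SET|%:R) ->
  (forall x y : {ffun 'I_k -> V}, separated x y ->
     exists i j, D (x i) (y j) && D (y j) (x i)) ->
  (forall w w' : {ffun 'I_m -> V}, separated w w' ->
     #|[set e : 'I_m * 'I_m | C (w e.1) (w' e.2)]%SET|%:R < a * (m * m)%:R) ->
  (forall u v u' v' : {ffun 'I_m -> V},
     separated u v -> separated u u' -> separated v v' ->
     #|[set e : 'I_m * 'I_m | ~~ D (u e.1) (u' e.2) && ~~ D (v e.1) (v' e.2)]%SET|%:R
       < b * (m * m)%:R) ->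
  injective f.
Proof.
move=> a0 b0 num Ha Hb He Hd Hc u v fuv; apply/eqP/negPn/negP => uv.
have a1 := Ha (f u); have b1 := Hb u v uv.
have Ule (A : {set V}) (c : R) : 0 <= c -> c * #|A|%:R <= c * #|V|%:R.
  by move=> c0; rewrite ler_wpM2l// ler_nat max_card.
have img := card_image_le uv fuv.
have fib w : (#|fibre w| <= k + k)%N by apply/ltnW/card_fibre_lt.
have tot := card_le_image_fibres fib.
set W := [set w | (1 < #|fibre w|)%N]%SET in tot.
have mW : (m + m <= #|W|)%N.
  have : (4 * k * m < (k + k) * #|W|)%N.
    rewrite -(ltr_nat R); move: img tot; rewrite -!(ler_nat R) !natrD.
    have := Ule [set~ f u]%SET a a0; have := Ule (~: [set u; v])%SET b b0.
    by move: a1 b1 num; lra.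
  by nia.
have [w [w' [ww' wW w'W]]] := separated_exists mW.
(* [g] selects two vertices in each fibre that has two. *)
have : forall x, exists g : V * V, x \in W -> [/\ f g.1 = x, f g.2 = x & g.1 != g.2].
  move=> x; case: (boolP (x \in W)) => [|_]; last by exists (x, x).
  rewrite inE => /card_gt1P[y [z [yx zx yz]]]; exists (y, z) => _ /=.
  by move: yx zx; rewrite !inE => /eqP -> /eqP ->.
move=> /choice[g gP].
have /separatedP[wI w'I wdis] := ww'.
have fg1 x : x \in W -> f (g x).1 = x by case/gP.
have fg2 x : x \in W -> f (g x).2 = x by case/gP.
pose u1 := [ffun i => (g (w i)).1]; pose v1 := [ffun i => (g (w i)).2].
pose u2 := [ffun i => (g (w' i)).1]; pose v2 := [ffun i => (g (w' i)).2].
have fu1 i : f (u1 i) = w i by rewrite ffunE fg1.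
have fv1 i : f (v1 i) = w i by rewrite ffunE fg2.
have fu2 i : f (u2 i) = w' i by rewrite ffunE fg1.
have fv2 i : f (v2 i) = w' i by rewrite ffunE fg2.
have inj_of (x y : {ffun 'I_m -> V}) : injective y -> (forall i, f (x i) = y i) -> injective x.
  by move=> yI xy i j /(congr1 f); rewrite !xy => /yI.
have dis_of (x y : {ffun 'I_m -> V}) : (forall i, f (x i) = w i) -> (forall i, f (y i) = w' i) ->
    forall i j, x i != y j.
  move=> xw yw' i j; apply/eqP => /(congr1 f); rewrite xw yw' => ww.
  by have := wdis i j; rewrite ww eqxx.
have sep1 : separated u1 v1.
  apply/separatedP; split; [exact: inj_of fu1|exact: inj_of fv1|move=> i j].
  apply/eqP => uvij; have ij : i = j by apply: wI; rewrite -fu1 uvij fv1.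
  by move: uvij; rewrite ij !ffunE => /eqP; apply/negP; case: (gP _ (wW j)).
have sep2 : separated u1 u2.
  by apply/separatedP; split; [exact: inj_of fu1|exact: inj_of fu2|exact: dis_of].
have sep3 : separated v1 v2.
  by apply/separatedP; split; [exact: inj_of fv1|exact: inj_of fv2|exact: dis_of].
have := Hc _ _ _ _ sep1 sep2 sep3; set U := [set e | _]%SET => Uc.
have := Hd _ _ ww'; set N := [set e | _]%SET => Nc.
(* An arc of D between the selected pairs forces one of C between their images. *)
have NU : (m * m <= #|N| + #|U|)%N.
  apply: leq_trans (leq_card_setU _ _).
  rewrite -[m in (m * m)%N]card_ord -card_prod -cardsT subset_leq_card//.
  apply/fintype.subsetP => e _; rewrite !inE.
  have [hom _] := f_hom.
  have ww i j : w i = w' j -> False by move=> e'; have := wdis i j; rewrite e' eqxx.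
  case: (boolP (D (u1 e.1) (u2 e.2))) => [/hom|_].
    by rewrite fu1 fu2 => -[/ww//|->].
  case: (boolP (D (v1 e.1) (v2 e.2))) => [/hom|_].
    by rewrite fv1 fv2 => -[/ww//|->].
  by rewrite orbT.
have n0 : 0 < #|V|%:R :> R by rewrite ltr0n; apply/card_gt0P; exists u.
have ab1 : a + b <= 1.
  rewrite -(ler_pM2r n0) mul1r mulrDl; apply: le_trans num.
  by rewrite natrM; have : 0 <= (4 * k)%:R * m%:R :> R by []; lra.
have : (a + b) * (m * m)%:R <= 1 * (m * m)%:R :> R by rewrite ler_wpM2r.
by move: NU; rewrite -(ler_nat R) natrD; lra.
Qed.

End CollisionCounting.

(** * Rare events for one random digraph *)

Definition off_diagonal (V : finType) : {set V * V} := [set a | a.1 != a.2]%SET.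

Section RandomDigraphEvents.
Context {R : realType} {O : finType}.
Variable mu : O -> R.
Hypothesis mu_ge0 : forall w, 0 <= mu w.
Variables (V : finType) (G : O -> digraph V) (p e : R).
Hypothesis p01 : 0 <= p <= 1.
Hypothesis e01 : 0 <= e <= 1.

Hypothesis Gp : independent mu (fun a w => G w a.1 a.2) p (off_diagonal V).

Let q2_01 : 0 <= (1 - p) ^+ 2 <= 1.
Proof. by have /andP[? ?] := p01; rewrite sqr_ge0 exprn_ile1//; lra. Qed.

(** Each of the following five events is the negation of one of the counting
hypotheses of [acyclic_hom_injective], for one random digraph. *)
Definition high_outdegree w :=
  [exists x in [set: V]%SET, (p + e) * #|[set~ x]%SET|%:R
     <= #|[set y in [set~ x] | G w x y]%SET|%:R].

Lemma prob_high_outdegree :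
  prob mu high_outdegree <= #|V|%:R * expR (- (e ^+ 2 * (#|V|%:R - 1) / 8)).
Proof.
apply: prob_exists_le => // x _.
apply: le_trans (prob_tail mu_ge0 p01 e01 (_ : independent mu (fun y w => G w x y) p [set~ x]%SET)) _.
  apply: (independent_inj (g := fun y => (x, y))) Gp => [y z _ _ [] //|y].
  by rewrite !inE eq_sym.
rewrite ler_expR lerN2 ler_pM2r ?invr_gt0// ler_wpM2l ?sqr_ge0//.
rewrite cardsC1; have : (0 < #|V|)%N by apply/card_gt0P; exists x.
by case: #|V| => // k _; rewrite /= -natr1; lra.
Qed.

Definition many_common_nonneighbours w :=
  [exists uv in [set uv : V * V | uv.1 != uv.2]%SET,
    ((1 - p) ^+ 2 + e) * #|(~: [set uv.1; uv.2])%SET|%:R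
     <= #|[set x in ~: [set uv.1; uv.2] | ~~ G w uv.1 x && ~~ G w uv.2 x]%SET|%:R].

Lemma prob_many_common_nonneighbours :
  prob mu many_common_nonneighbours
    <= (#|V| ^ 2)%:R * expR (- (e ^+ 2 * (#|V|%:R - 2) / 8)).
Proof.
rewrite expnS expn1 -card_prod; apply: prob_exists_le => // -[u v]; rewrite inE /= => uv.
apply: le_trans (prob_tail mu_ge0 q2_01 e01 (_ : independent mu
  (fun x w => ~~ G w u x && ~~ G w v x) _ (~: [set u; v])%SET)) _.
  apply: (independent_inj2 (g1 := fun y => (u, y)) (g2 := fun y => (v, y)))
     (independent_compl Gp) => [y z _ _ []//|y z _ _ []//|y z _ _|y|y].
  - by apply/eqP => -[] /eqP; rewrite (negbTE uv).
  - by rewrite !inE negb_or eq_sym => /andP[].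
  - by rewrite !inE negb_or [v == _]eq_sym => /andP[].
rewrite ler_expR lerN2 ler_pM2r ?invr_gt0// ler_wpM2l ?sqr_ge0//.
have : (#|V| <= #|~: [set u; v]%SET| + 2)%N.
  by have := cardsC [set u; v]%SET; rewrite cards2 uv; lia.
by rewrite -(ler_nat R) natrD; lra.
Qed.

Definition digon_free_pair k w :=
  [exists z in [set z : {ffun 'I_k -> V} * {ffun 'I_k -> V} | separated z.1 z.2]%SET,
    [forall a in [set: 'I_k * 'I_k]%SET,
      ~~ (G w (z.1 a.1) (z.2 a.2) && G w (z.2 a.2) (z.1 a.1))]].

Lemma prob_digon_free_pair k :
  prob mu (digon_free_pair k) <= (#|V| ^ (2 * k))%:R * expR (- (p ^+ 2 * (k * k)%:R)).
Proof.
have -> : (#|V| ^ (2 * k))%N = #|{: {ffun 'I_k -> V} * {ffun 'I_k -> V}}|.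
  by rewrite card_prod card_ffun card_ord mul2n -addnn expnD.
apply: prob_exists_le => // -[x y]; rewrite inE /= => /separatedP[xI yI xy].
rewrite (prob_none (r := p ^+ 2)); last first.
  apply: (independent_inj2 (g1 := fun a => (x a.1, y a.2)) (g2 := fun a => (y a.2, x a.1))) Gp.
  - by move=> [i j] [i' j'] _ _ [/= /xI -> /yI ->].
  - by move=> [i j] [i' j'] _ _ [/= /yI -> /xI ->].
  - by move=> [i j] [i' j'] _ _; apply/eqP => -[/= /eqP]; rewrite (negbTE (xy _ _)).
  - by move=> [i j] _; rewrite inE xy.
  - by move=> [i j] _; rewrite inE eq_sym xy.
rewrite cardsT card_prod card_ord -[X in expR X]mulNr expRM_natr lerXn2r ?nnegrE ?expR_ge0//.
  by have /andP[? ?] := p01; rewrite subr_ge0 exprn_ile1.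
by apply: le_trans (expR_ge1Dx _).
Qed.

Definition dense_pair m w :=
  [exists z in [set z : {ffun 'I_m -> V} * {ffun 'I_m -> V} | separated z.1 z.2]%SET,
    (p + e) * (m * m)%:R
     <= #|[set a : 'I_m * 'I_m | G w (z.1 a.1) (z.2 a.2)]%SET|%:R].

Lemma prob_dense_pair m :
  prob mu (dense_pair m) <= (#|V| ^ (2 * m))%:R * expR (- (e ^+ 2 * (m * m)%:R / 8)).
Proof.
have -> : (#|V| ^ (2 * m))%N = #|{: {ffun 'I_m -> V} * {ffun 'I_m -> V}}|.
  by rewrite card_prod card_ffun card_ord mul2n -addnn expnD.
apply: prob_exists_le => // -[x y]; rewrite inE /= => /separatedP[xI yI xy].
have ind : independent mu (fun a w => G w (x a.1) (y a.2)) p [set: 'I_m * 'I_m]%SET.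
  apply: (independent_inj (g := fun a => (x a.1, y a.2))) Gp.
  - by move=> [i j] [i' j'] _ _ [/= /xI -> /yI ->].
  - by move=> [i j] _; rewrite inE xy.
have := prob_tail mu_ge0 p01 e01 ind; rewrite cardsT card_prod card_ord.
apply: le_trans; apply: prob_sub => // w.
by congr (_ <= _%:R); apply: eq_card => a; rewrite !inE.
Qed.

Definition sparse_double_pair m w :=
  [exists z in [set z : ({ffun 'I_m -> V} * {ffun 'I_m -> V}) *
                        ({ffun 'I_m -> V} * {ffun 'I_m -> V}) |
                [&& separated z.1.1 z.1.2, separated z.1.1 z.2.1
                  & separated z.1.2 z.2.2]]%SET,
    ((1 - p) ^+ 2 + e) * (m * m)%:R
     <= #|[set a : 'I_m * 'I_m | ~~ G w (z.1.1 a.1) (z.2.1 a.2)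
                              && ~~ G w (z.1.2 a.1) (z.2.2 a.2)]%SET|%:R].

Lemma prob_sparse_double_pair m :
  prob mu (sparse_double_pair m)
    <= (#|V| ^ (4 * m))%:R * expR (- (e ^+ 2 * (m * m)%:R / 8)).
Proof.
have -> : (#|V| ^ (4 * m))%N = #|{: ({ffun 'I_m -> V} * {ffun 'I_m -> V}) *
                        ({ffun 'I_m -> V} * {ffun 'I_m -> V})}|.
  by rewrite !card_prod card_ffun card_ord -!expnD; congr (_ ^ _)%N; lia.
apply: prob_exists_le => // -[[u v] [u' v']]; rewrite inE /=.
move=> /and3P[/separatedP[uI vI uv] /separatedP[_ u'I uu'] /separatedP[_ v'I vv']].
have ind : independent mu (fun a w => ~~ G w (u a.1) (u' a.2) && ~~ G w (v a.1) (v' a.2))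
    ((1 - p) ^+ 2) [set: 'I_m * 'I_m]%SET.
  apply: (independent_inj2 (g1 := fun a => (u a.1, u' a.2)) (g2 := fun a => (v a.1, v' a.2)))
     (independent_compl Gp).
  - by move=> [i j] [i' j'] _ _ [/= /uI -> /u'I ->].
  - by move=> [i j] [i' j'] _ _ [/= /vI -> /v'I ->].
  - by move=> [i j] [i' j'] _ _; apply/eqP => -[/= /eqP]; rewrite (negbTE (uv _ _)).
  - by move=> [i j] _; rewrite inE uu'.
  - by move=> [i j] _; rewrite inE vv'.
have := prob_tail mu_ge0 q2_01 e01 ind; rewrite cardsT card_prod card_ord.
apply: le_trans; apply: prob_sub => // w.
by congr (_ <= _%:R); apply: eq_card => a; rewrite !inE.
Qed.

End RandomDigraphEvents.

(** * Choice of parameters in the window *)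

Lemma ler_sqr_nneg (R : realDomainType) (x y : R) : 0 <= x -> x <= y -> x ^+ 2 <= y ^+ 2.
Proof. by move=> x0 xy; rewrite lerXn2r ?nnegrE// (le_trans x0). Qed.

(** One of [p] and [1 - p] is at least [1 / 2], and the other one satisfies the
lower bound of the window. *)
Lemma variance_lower (R : realFieldType) (p t Y : R) : 0 < t -> 0 < Y ->
  Y <= p * t -> Y <= (1 - p) * t -> Y / 2 <= p * (1 - p) * t.
Proof.
move=> t0 Y0 Yp Yq.
have p0 : 0 < p by rewrite -(pmulr_lgt0 _ t0) (lt_le_trans Y0).
have q0 : 0 < 1 - p by rewrite -(pmulr_lgt0 _ t0) (lt_le_trans Y0).
have [ph|ph] := leP p (1 / 2).
  have : p * t * (1 / 2) <= p * t * (1 - p).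
    rewrite ler_wpM2l//; first by rewrite mulr_ge0 ?ltW.
    by clear -ph; lra.
  by clear -Yp; lra.
have : (1 - p) * t * (1 / 2) <= (1 - p) * t * p.
  by rewrite ler_wpM2l ?mulr_ge0 ?ltW.
by clear -Yq; lra.
Qed.

(** In terms of [t = n^(1/9)], the window says that [p] and [1 - p] both exceed
[L ^+ 2 / t]. *)
Lemma in_window_root (R : realType) (n : nat) (p : R) : (0 < n)%N -> in_window n p ->
  let t : R := n%:R `^ (1 / 9) in let L : R := ln n%:R in
  [/\ 1 <= t, t ^+ 9 = n%:R, L ^+ 2 < p * t & L ^+ 2 < (1 - p) * t].
Proof.
move=> n0 + t L; rewrite /in_window -/L powRN -/t.
have n1 : 1 <= n%:R :> R by rewrite ler1n.
have t1 : 1 <= t.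
  by have := @ler_powR R n%:R n1 0 (1 / 9); rewrite powRr0 /t; apply; clear; lra.
have t0 : 0 < t := lt_le_trans ltr01 t1.
rewrite mulrC ltrBrDr -ltrBrDl !ltr_pdivrMr// => /andP[Lp Lq]; split => //.
rewrite -powR_mulrn ?ltW// /t -powRrM.
have -> : 1 / 9 * 9%:R = 1 :> R by clear; lra.
by rewrite powRr1// ltW// ltr0n.
Qed.

(** From here to [window_parameters], [L] stands for the logarithm of [N], [t]
for its ninth root and [r] for the integer part of [t]. Halving a bound in [t]
gives one in [r], as [t <= r + 1 <= 2 * r]; and [L >= 100] absorbs all
constants, through [L ^+ 4 >= 10 ^+ 6 * L]. *)
Section WindowEstimates.
Context {R : realFieldType}.
Variables (N t L p e : R) (r : nat).
Hypotheses (tN : t ^+ 9 = N) (L100 : 100 <= L) (LN : L < N) (t1 : 1 <= t).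
Hypotheses (p0 : 0 <= p) (Lp : L ^+ 2 <= p * t) (e0 : 0 <= e) (Le : L ^+ 2 / 8 <= e * t).
Hypotheses (r1 : 1 <= r%:R :> R) (rt : r%:R <= t) (tr : t <= r%:R + 1).

Let L0 : 0 <= L. Proof. by move: L100; lra. Qed.

Let L3 : 100 * L <= L ^+ 2.
Proof. by rewrite expr2 ler_wpM2r. Qed.

Let L4 : 10 ^+ 6 * L <= (L ^+ 2) ^+ 2.
Proof.
have -> : 10 ^+ 6 * L = (10 ^+ 4) * (100 * L) by ring.
rewrite [leRHS]expr2 ler_pM// ?mulr_ge0//.
by move: L3 L100; lra.
Qed.

Let t0 : 0 <= t. Proof. exact: le_trans t1. Qed.

Let er : L ^+ 2 / 16 <= e * r%:R.
Proof.
have : e * t <= e * (2 * r%:R) by rewrite ler_wpM2l//; move: tr r1; lra.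
by move: Le; lra.
Qed.

(** The gap of [4 * k * m] vertices has order [t ^+ 8], and [2 * e * N] is at
least [L ^+ 2 / 4 * t ^+ 8]. *)
Lemma collision_budget (k m : nat) : k%:R = (r%:R + 1) ^+ 2 :> R -> m%:R = r%:R ^+ 6 :> R ->
  1 + (4 * k * m)%:R <= 2 * (e * N).
Proof.
move=> kE mE; rewrite !natrM kE mE.
have A : (r%:R + 1) ^+ 2 * r%:R ^+ 6 <= 4 * t ^+ 8 :> R.
  have -> : 4 * t ^+ 8 = (2 * t) ^+ 2 * t ^+ 6 :> R by ring.
  have r0 : 0 <= r%:R + 1 :> R by rewrite addr_ge0.
  rewrite ler_pM ?exprn_ge0//.
    by rewrite ler_sqr_nneg//; move: rt t1; lra.
  by rewrite lerXn2r ?nnegrE.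
have B : L ^+ 2 / 8 * t ^+ 8 <= e * N.
  by rewrite -tN [t ^+ 9]exprS mulrA ler_wpM2r// exprn_ge0.
have C : 1 <= t ^+ 8 by apply: exprn_ege1.
have E : 10000 * t ^+ 8 <= L ^+ 2 * t ^+ 8.
  by rewrite ler_wpM2r ?exprn_ge0//; move: L3 L100; lra.
rewrite -(mulrA 4%:R).
move: A B C E; move: (t ^+ 8) (e * N) (_ * r%:R ^+ 6) => T M X; lra.
Qed.

(** Exponent in the tail bounds for neighbourhoods, against the [n ^ 2] choices
of vertices: already [e ^+ 2 * t ^+ 2] has order [L ^+ 4]. *)
Lemma degree_exponent : 3 * L <= e ^+ 2 * (N - 2) / 8.
Proof.
have en : (L ^+ 2 / 8) ^+ 2 <= e ^+ 2 * N.
  have h : (L ^+ 2 / 8) ^+ 2 <= (e * t) ^+ 2 by rewrite ler_sqr_nneg// divr_ge0// exprn_ge0.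
  by apply: (le_trans h); rewrite -tN exprMn ler_wpM2l ?sqr_ge0// ler_weXn2l.
have n4 : 4 <= N by move: LN L100; lra.
have : e ^+ 2 * (N / 2) <= e ^+ 2 * (N - 2).
  by rewrite ler_wpM2l ?sqr_ge0//; move: n4; lra.
by move: en L4 L0; move: (L ^+ 2) => Y; move: (e ^+ 2) => Z; lra.
Qed.

(** Exponent of the probability that two given [k]-sets are not joined by a
digon, against the [n ^ (2 * k)] choices: [p ^+ 2 * k >= L ^+ 4] suffices. *)
Lemma digon_exponent (k : nat) : k%:R = (r%:R + 1) ^+ 2 :> R ->
  ((2 * k)%:R + 1) * L <= p ^+ 2 * (k * k)%:R.
Proof.
move=> kE; rewrite !natrM; set K : R := k%:R.
have k1 : 1 <= K by rewrite /K kE exprn_ege1// lerDr.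
have h : (L ^+ 2) ^+ 2 <= p ^+ 2 * K.
  rewrite /K kE -exprMn ler_sqr_nneg ?sqr_ge0//.
  by apply: (le_trans Lp); rewrite ler_wpM2l.
have h1 : 3 * L * K <= (p ^+ 2 * K) * K.
  rewrite ler_wpM2r//; apply: le_trans h.
  by move: L4 L0; lra.
have h2 : L * 1 <= L * K by rewrite ler_wpM2l.
by rewrite mulrA; apply: le_trans h1; move: h2; lra.
Qed.

(** Exponent in the tail bounds for [m * m] trials, against the [n ^ (4 * m)]
choices of four [m]-sets: [e ^+ 2 * m >= L ^+ 4 / 256] suffices. *)
Lemma density_exponent (m : nat) : m%:R = r%:R ^+ 6 :> R ->
  ((4 * m)%:R + 1) * L <= e ^+ 2 * (m * m)%:R / 8.
Proof.
move=> mE; rewrite !natrM; set M : R := m%:R.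
have m1 : 1 <= M by rewrite /M mE exprn_ege1.
have h : (L ^+ 2 / 16) ^+ 2 <= e ^+ 2 * M.
  apply: (@le_trans _ _ ((e * r%:R) ^+ 2)).
    by rewrite ler_sqr_nneg// divr_ge0// sqr_ge0.
  by rewrite exprMn ler_wpM2l ?sqr_ge0// /M mE ler_weXn2l.
have h1 : 5 * L * M <= (e ^+ 2 * M) / 8 * M.
  rewrite ler_wpM2r//; move: h L4 L0; move: (L ^+ 2) (e ^+ 2 * M) => Y Z; lra.
have h2 : L * 1 <= L * M by rewrite ler_wpM2l.
have -> : e ^+ 2 * (M * M) / 8 = (e ^+ 2 * M) / 8 * M by ring.
by apply: le_trans h1; move: h2; lra.
Qed.

End WindowEstimates.

Lemma window_parameters (R : realType) (n : nat) (p : R) :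
  100 <= ln n%:R :> R -> in_window n p ->
  let e := p * (1 - p) / 4 in let L := ln n%:R in
  [/\ (0 < n)%N, 0 <= p <= 1, 0 <= e <= 1 & exists k m : nat,
  [/\ 1 + (p + e) * n%:R + ((1 - p) ^+ 2 + e) * n%:R + (4 * k * m)%:R <= n%:R,
      3 * L <= e ^+ 2 * (n%:R - 2) / 8,
      ((2 * k)%:R + 1) * L <= p ^+ 2 * (k * k)%:R &
      ((4 * m)%:R + 1) * L <= e ^+ 2 * (m * m)%:R / 8]].
Proof.
move=> L100 win /=.
have n0 : (0 < n)%N by case: n L100 {win} => // h; move: h; rewrite ln0//; clear; lra.
have [] := in_window_root n0 win.
have LN : ln n%:R < n%:R :> R by rewrite ln_sublinear// ltr0n.
move: L100 LN; move: (n%:R `^ (1 / 9)) (ln n%:R) => t L L100 LN t1 tN Lp Lq.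
have t0 : 0 < t := lt_le_trans ltr01 t1.
have L20 : 0 < L ^+ 2 by rewrite exprn_gt0//; move: L100; clear; lra.
have := variance_lower t0 L20 (ltW Lp) (ltW Lq).
have p0 : 0 <= p by rewrite -(pmulr_lge0 _ t0) ltW// (lt_trans L20).
have q0 : 0 <= 1 - p by rewrite -(pmulr_lge0 _ t0) ltW// (lt_trans L20).
set e := p * (1 - p) / 4 => v.
have Le : L ^+ 2 / 8 <= e * t by rewrite /e; move: v; clear; lra.
have e0 : 0 <= e by rewrite divr_ge0// mulr_ge0.
have p1 : p <= 1 by rewrite -subr_ge0.
have e1 : e <= 1.
  have : p * (1 - p) <= 1 * 1 by rewrite ler_pM// gerBl.
  by rewrite /e; clear; lra.
split; rewrite ?p0 ?p1 ?e0 ?e1//.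
pose r := Num.trunc t; have /andP[rt tr] : r%:R <= t < r.+1%:R by apply: truncn_itv; rewrite ltW.
have r1 : 1 <= r%:R :> R by rewrite ler1n truncn_gt0.
rewrite -natr1 in tr; have {}tr := ltW tr.
exists (r.+1 ^ 2)%N, (r ^ 6)%N.
have kE : (r.+1 ^ 2)%:R = (r%:R + 1) ^+ 2 :> R by rewrite natrX natr1.
have mE := natrX R r 6.
move: (r.+1 ^ 2)%N (r ^ 6)%N kE mE => k m kE mE; split.
- have := collision_budget tN L100 t1 Le rt kE mE.
  have -> : (p + e) * n%:R = p * n%:R + e * n%:R by clear; ring.
  (* [p + (1 - p) ^+ 2 = 1 - 4 * e], so the densities add up to [1 - 2 * e]. *)
  have -> : ((1 - p) ^+ 2 + e) * n%:R = n%:R - p * n%:R - 4 * (e * n%:R) + e * n%:R.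
    by rewrite /e; clear; field.
  by move: (e * n%:R) (p * n%:R) => X Y; clear; lra.
- exact: (degree_exponent tN L100 LN t1 Le).
- exact: (digon_exponent L100 p0 (ltW Lp) tr kE).
- exact: (density_exponent L100 e0 Le r1 tr mE).
Qed.

(** * The union bound *)

(** [n ^ j] choices cost a factor [expR (j * ln n)], and one more [ln n] in the
exponent leaves [n^-1]. *)
Lemma union_bound_le (R : realType) (n j : nat) (z : R) : (0 < n)%N ->
  (j%:R + 1) * ln n%:R <= z -> (n ^ j)%:R * expR (- z) <= n%:R^-1.
Proof.
move=> n0 jz; have nE : n%:R = expR (ln n%:R) :> R by rewrite lnK// posrE ltr0n.
rewrite natrX [in leRHS]nE [in leLHS]nE -expRN -expRM_natr -expRD ler_expR; lra.
Qed.

Definition only_injective_homs (V W : finType) (D : digraph V) (C : digraph W) : Prop :=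
  forall f : V -> W, acyclic_hom D C f -> injective f.

Section FiniteSpace.
Context {R : realType} {O : finType}.
Variable mu : O -> R.
Hypothesis mu_ge0 : forall w, 0 <= mu w.
Variables (n : nat) (D C : O -> digraph 'I_n) (p : R).
Hypothesis Dp : independent mu (fun a w => D w a.1 a.2) p (off_diagonal 'I_n).
Hypothesis Cp : independent mu (fun a w => C w a.1 a.2) p (off_diagonal 'I_n).

Lemma prob_noninjective_hom : 100 <= ln n%:R :> R -> in_window n p ->
  prob mu (fun w => ~~ `[< only_injective_homs (D w) (C w) >]) <= 5 * n%:R^-1.
Proof.
move=> L100 win; have := window_parameters L100 win.
set e := p * (1 - p) / 4; set L := ln n%:R => /= -[n0 p01 e01 [k [m [num deg dig den]]]].
pose bad w := high_outdegree C p e w || (many_common_nonneighbours D p e w ||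
  (digon_free_pair D k w || (dense_pair C p e m w || sparse_double_pair D p e m w))).
have [p0 p1] := andP p01; have [e0 e1] := andP e01.
apply: (@le_trans _ _ (prob mu bad)).
  apply: prob_sub => // w; apply: contraR; rewrite /bad !negb_or.
  case/and5P => /exists_inPn Ha /exists_inPn Hb /exists_inPn He /exists_inPn Hd /exists_inPn Hc.
  apply/asboolP => f fhom.
  apply: (acyclic_hom_injective fhom (k := k) (m := m) (a := p + e) (b := (1 - p) ^+ 2 + e)).
  - by rewrite addr_ge0.
  - by rewrite addr_ge0 ?sqr_ge0.
  - by rewrite card_ord.
  - by move=> v; rewrite ltNge; apply: Ha; rewrite inE.
  - by move=> u v uv; rewrite ltNge; apply: (Hb (u, v)); rewrite inE.
  - move=> x y xy; have := He (x, y); rewrite inE => /(_ xy) /forall_inPn[[i j] _ /negPn].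
    by exists i, j.
  - by move=> x y xy; rewrite ltNge; apply: (Hd (x, y)); rewrite inE.
  - by move=> u v u' v' h1 h2 h3; rewrite ltNge; apply: (Hc ((u, v), (u', v'))); rewrite inE /= h1 h2.
have L0 : 0 <= L by move: L100; rewrite -/L; lra.
have Pa : prob mu (high_outdegree C p e) <= n%:R^-1.
  apply: le_trans (prob_high_outdegree mu_ge0 p01 e01 Cp) _.
  rewrite card_ord -[n in n%:R * _]expn1 union_bound_le// -/L.
  apply: (@le_trans _ _ (3 * L)); first by move: L0; lra.
  apply: (le_trans deg); rewrite ler_pM2r// ler_wpM2l ?sqr_ge0// lerD2l; lra.
have Pb : prob mu (many_common_nonneighbours D p e) <= n%:R^-1.
  apply: le_trans (prob_many_common_nonneighbours mu_ge0 p01 e01 Dp) _.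
  rewrite card_ord union_bound_le// -/L.
  by apply: le_trans deg; move: L0; lra.
have Pe : prob mu (digon_free_pair D k) <= n%:R^-1.
  apply: le_trans (prob_digon_free_pair mu_ge0 p01 Dp k) _.
  by rewrite card_ord union_bound_le.
have Pd : prob mu (dense_pair C p e m) <= n%:R^-1.
  apply: le_trans (prob_dense_pair mu_ge0 p01 e01 Cp m) _.
  rewrite card_ord union_bound_le// -/L; apply: le_trans den.
  by rewrite ler_wpM2r// lerD2r ler_nat leq_mul2r orbT.
have Pc : prob mu (sparse_double_pair D p e m) <= n%:R^-1.
  apply: le_trans (prob_sparse_double_pair mu_ge0 p01 e01 Dp m) _.
  by rewrite card_ord union_bound_le.
have -> : 5 * n%:R^-1 = n%:R^-1 + (n%:R^-1 + (n%:R^-1 + (n%:R^-1 + n%:R^-1))) :> R.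
  by move: n%:R^-1 => x; lra.
by do 4![apply: le_trans (prob_or mu_ge0 _ _) _; apply: lerD => //].
Qed.

End FiniteSpace.

(** * Transfer to the probability space *)

Section Pushforward.
Context {d : measure_display} {T : measurableType d} {R : realType}.
Variables (P : probability T R) (O : finType) (F : T -> O).
Hypothesis mF : forall o, measurable (F @^-1` [set o]).

Definition pushforward_mass (o : O) : R := fine (P (F @^-1` [set o])).

Lemma pushforward_mass_ge0 o : 0 <= pushforward_mass o.
Proof. by rewrite fine_ge0. Qed.

Let preimageE (Q : pred O) : [set t | Q (F t)] = \bigcup_(o in [set` Q]) F @^-1` [set o].
Proof.
by apply/seteqP; split => t; [move=> Qt; exists (F t)|by case=> o Qo Fo; rewrite /= Fo].
Qed.

Lemma measurable_finite_preimage (Q : pred O) : measurable [set t | Q (F t)].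
Proof. by rewrite preimageE; apply: fin_bigcup_measurable. Qed.

Lemma prob_pushforward (Q : pred O) :
  P [set t | Q (F t)] = (prob pushforward_mass Q)%:E.
Proof.
rewrite preimageE measure_fin_bigcup//; last exact: trivIset_preimage1.
rewrite -(@bigfs _ _ _ _ (index_enum O)) ?index_enum_uniq//; last by move=> o _; rewrite mem_index_enum.
rewrite /prob -sumEFin; apply: eq_bigr => o _.
by rewrite /pushforward_mass fineK// fin_num_measure.
Qed.

End Pushforward.

(** Irreflexivity is an equation between booleans, so its proofs agree and a
digraph is determined by its arcs. *)
Lemma digraph_eq (V : finType) (G H : digraph V) : (forall u v, G u v = H u v) -> G = H.
Proof.
case: G H => [g gi] [h hi] /= gh; have E : g = h by apply/funext => u; apply/funext => v.
by rewrite -E in hi *; congr Digraph; apply: Prop_irrelevance.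
Qed.

Definition arc_pattern (V : finType) (G : digraph V) : {ffun V * V -> bool} :=
  [ffun a => G a.1 a.2].

(** The diagonal of a pattern is ignored, so that every pattern, and not only
those of digraphs, yields a digraph. *)
Definition pattern_arc (V : finType) (A : {ffun V * V -> bool}) : rel V :=
  fun u v => (u != v) && A (u, v).

Lemma pattern_arc_irrefl (V : finType) (A : {ffun V * V -> bool}) :
  irreflexive (pattern_arc A).
Proof. by move=> u; rewrite /pattern_arc eqxx. Qed.

Definition digraph_of_pattern (V : finType) (A : {ffun V * V -> bool}) : digraph V :=
  Digraph (pattern_arc_irrefl A).

Lemma arc_patternK (V : finType) : cancel (@arc_pattern V) (@digraph_of_pattern V).
Proof.
move=> G; apply: digraph_eq => u v; rewrite /= /pattern_arc ffunE /=.
by case: eqVneq => [->|//]; rewrite arc_irrefl.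
Qed.

Section RandomPattern.
Context {d : measure_display} {T : measurableType d} {R : realType}.
Variables (P : probability T R) (n : nat) (p : R).

(** The diagonal pairs need a separate case: their events are trivial, as
digraphs are loopless. *)
Lemma measurable_arc_pattern (G : T -> digraph 'I_n) A :
  random_digraph P p G -> measurable [set t | arc_pattern (G t) = A].
Proof.
case=> mG _ _.
have -> : [set t | arc_pattern (G t) = A] =
    \bigcap_(a in [set: 'I_n * 'I_n]) [set t | G t a.1 a.2 = A a].
  apply/seteqP; split => [t /= <- a _ /=|t H]; first by rewrite ffunE.
  by apply/ffunP => a; rewrite ffunE; apply: H.
apply: fin_bigcap_measurable => // a _.
have [aE|aN] := eqVneq a.1 a.2.
  case E : (A a).
    rewrite (_ : [set _ | _] = set0)//; apply/seteqP; split => // t /=.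
    by rewrite aE arc_irrefl.
  rewrite (_ : [set _ | _] = setT)//; apply/seteqP; split => // t _ /=.
  by rewrite aE arc_irrefl.
have ma : measurable [set t | G t a.1 a.2] by apply: mG; rewrite inE.
case: (A a) => //; rewrite (_ : [set _ | _] = ~` [set t | G t a.1 a.2]).
  exact: measurableC.
by apply/seteqP; split => t /=; [move=> ->|move/negP/negbTE].
Qed.

Lemma independent_arcs (O : finType) (F : T -> O) (H : O -> digraph 'I_n) (G : T -> digraph 'I_n) :
  (forall o, measurable (F @^-1` [set o])) -> (forall t, H (F t) = G t) ->
  random_digraph P p G ->
  independent (pushforward_mass P F) (fun a o => H o a.1 a.2) p (off_diagonal 'I_n).
Proof.
move=> mF HF [_ Gp Gind] S SJ; apply: EFin_inj; rewrite -prob_pushforward//.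
rewrite -prodr_const -prodEFin; have := Gind S SJ.
rewrite (eq_bigr (fun=> p%:E)) => [<-|a aS]; last by apply/Gp/(fintype.subsetP SJ).
congr (P _); apply/seteqP; split => t /=.
  by move=> /forall_inP h a /h; rewrite HF.
by move=> h; apply/forall_inP => a aS; rewrite HF; apply: h.
Qed.

(** Whether every acyclic homomorphism is injective depends only on the pair of
arc patterns of [D t] and [C t]. On the finite set of such pairs, with the
weights induced by [P], both digraphs have independent arcs, and this does not
involve the dependence between the two. *)
Lemma only_injective_homs_ge (D C : T -> digraph 'I_n) :
  100 <= ln n%:R :> R -> in_window n p ->
  random_digraph P p D -> random_digraph P p C ->
  ((1 - 5 * n%:R^-1)%:E <= P [set t | only_injective_homs (D t) (C t)] <= 1)%E.
Proof.
move=> L100 win Dp Cp.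
pose F t := (arc_pattern (D t), arc_pattern (C t)).
pose D' (o : {ffun 'I_n * 'I_n -> bool} * {ffun 'I_n * 'I_n -> bool}) := digraph_of_pattern o.1.
pose C' (o : {ffun 'I_n * 'I_n -> bool} * {ffun 'I_n * 'I_n -> bool}) := digraph_of_pattern o.2.
have DF t : D' (F t) = D t by rewrite /D' arc_patternK.
have CF t : C' (F t) = C t by rewrite /C' arc_patternK.
have mF o : measurable (F @^-1` [set o]).
  rewrite (_ : _ @^-1` _ = [set t | arc_pattern (D t) = o.1] `&` [set t | arc_pattern (C t) = o.2]).
    by apply: measurableI; apply: measurable_arc_pattern.
  by case: o => A B; apply/seteqP; split => t /=; case=> <- <-.
pose Q o := `[< only_injective_homs (D' o) (C' o) >].
have EQ : [set t | only_injective_homs (D t) (C t)] = [set t | Q (F t)].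
  apply/seteqP; split => t /=; rewrite /Q DF CF.
    by move=> ?; apply/asboolP.
  by move=> /asboolP.
have mQ := measurable_finite_preimage mF Q.
rewrite EQ probability_le1// andbT.
have -> : P [set t | Q (F t)] = (1 - P [set t | ~~ Q (F t)])%E.
  rewrite -probability_setC; last exact: (measurable_finite_preimage mF (fun o => ~~ Q o)).
  by congr (P _); apply/seteqP; split => t /=; [move=> ->|move=> /negP/negPn].
rewrite (prob_pushforward P mF (fun o => ~~ Q o)) -EFinB lee_fin lerB//.
apply: (prob_noninjective_hom _ _ _ L100 win); first exact: pushforward_mass_ge0.
  exact: independent_arcs Dp.
exact: independent_arcs Cp.
Qed.

End RandomPattern.

Theorem theorem3p1 (R : realType) (p : nat -> R)
    (hp : \forall n \near \oo, in_window n (p n))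
    (d : nat -> measure_display) (T : forall n : nat, measurableType (d n))
    (P : forall n : nat, probability (T n) R)
    (D C : forall n : nat, T n -> digraph 'I_n)
    (hD : forall n : nat, in_window n (p n) -> random_digraph (P n) (p n) (D n))
    (hC : forall n : nat, in_window n (p n) -> random_digraph (P n) (p n) (C n)) :
  P n [set t | forall f : 'I_n -> 'I_n,
                 acyclic_hom (D n t) (C n t) f -> injective f]
    @[n --> \oo] --> 1%E.
Proof.
apply: (@squeeze_cvge _ _ _ _ (fun n => (1 - 5 * n%:R^-1)%:E) _ (fun=> 1%E)); last exact: cvg_cst.
  near=> n.
  have win : in_window n (p n) by near: n.
  (* [n >= expR 100] gives the bound [ln n >= 100] behind all estimates. *)
  have n_big : expR 100 <= n%:R :> R by near: n; exact: nbhs_infty_ger.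
  apply: only_injective_homs_ge (win) (hD n win) (hC n win).
  have n0 : 0 < n%:R :> R := lt_le_trans (expR_gt0 _) n_big.
  by rewrite -(expRK 100) ler_ln ?posrE ?expR_gt0.
apply: cvg_EFin; first by near=> n.
rewrite -[X in _ --> X]subr0; apply: cvgB; first exact: cvg_cst.
rewrite -[X in _ --> X](mulr0 5); apply: cvgM; first exact: cvg_cst.
by rewrite -(cvg_shiftS _); exact: cvg_harmonic.
Unshelve. all: by end_near. Qed.
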